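(* Let $X\sim p(\bm x,\bm\theta)$ on $\mathbb R^d$ and let $\hat{\bm\theta}=(\hat\theta_1,\dots,\hat\theta_m):\mathbb R^d\to\mathbb R^m$ be an estimator whose components are three times continuously differentiable with bounded third derivatives and such that $\hat\theta_a$, their first and second derivatives have finite second moments under $p(\cdot,\bm\theta)$. Let $Z=\sigma W$ where $W$ is independent of $X$, $\mathrm E[W]=0$, $\mathrm{Var}[W]=I$, and $W$ has finite moments of all orders. Then for all $a,b$, $$\mathrm{Var}^W_{\theta}[\hat{\bm\theta}]_{ab}=\lim_{\sigma^2\to0}\frac{\mathrm{Var}_\theta[\hat{\bm\theta}(X+Z)]_{ab}-\mathrm{Var}_\theta[\hat{\bm\theta}(X)]_{ab}}{\sigma^2}-\frac12\Big(\mathrm{Cov}_\theta[\hat\theta_a(X),\Delta\hat\theta_b(X)]+\mathrm{Cov}_\theta[\hat\theta_b(X),\Delta\hat\theta_a(X)]\Big),$$ where $\Delta$ is the Laplacian. In particular, if $\Delta\hat\theta_a$ is constant for every $a$ (e.g. each $\hat\theta_a$ is a quadratic polynomial in $\bm x$), then $\mathrm{Var}^W_\theta[\hat{\bm\theta}]=\lim_{\sigma^2\to0}\big(\mathrm{Var}_\theta[\hat{\bm\theta}(X+Z)]-\mathrm{Var}_\theta[\hat{\bm\theta}(X)]\big)/\sigma^2$.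
   Context: The Wasserstein covariance matrix of an estimator $\hat{\bm\theta}$ (with $\nabla_{\bm x}\hat\theta_a$ square integrable) is the $m\times m$ matrix $\mathrm{Var}^W_\theta[\hat{\bm\theta}]_{ab}=\mathrm E_\theta[(\nabla_{\bm x}\hat\theta_a)^\top(\nabla_{\bm x}\hat\theta_b)]$. $\mathrm{Var}_\theta[\cdot]$ denotes the ordinary covariance matrix. *)

(* Defs.v *)
From HB Require Import structures.
From mathcomp Require Import all_boot all_order all_algebra.
From mathcomp Require Import all_classical all_reals all_analysis.
Set Implicit Arguments. Unset Strict Implicit. Unset Printing Implicit Defensive.
Import Order.TTheory GRing.Theory Num.Theory.
Import numFieldNormedType.Exports.
Local Open Scope classical_set_scope.
Local Open Scope ring_scope.

Section Defs.
Context {R : realType} {n : nat}.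

Definition basis_vec (i : 'I_n) : 'rV[R]_n := delta_mx 0 i.

Definition partial (i : 'I_n) (f : 'rV[R]_n -> R) : 'rV[R]_n -> R :=
  fun x => derive f x (basis_vec i).

Fixpoint dpartial (s : seq 'I_n) (f : 'rV[R]_n -> R) : 'rV[R]_n -> R :=
  match s with
  | [::] => f
  | i :: s' => partial i (dpartial s' f)
  end.

Definition C3_bounded_third (f : 'rV[R]_n -> R) : Prop :=
  [/\ (forall (s : seq 'I_n) (i : 'I_n) (x : 'rV[R]_n),
          (size s < 3)%N -> derivable (dpartial s f) x (basis_vec i)),
      (forall s : seq 'I_n, (size s <= 3)%N -> continuous (dpartial s f)) &
      (forall s : seq 'I_n, size s = 3%N ->
          exists M : R, forall x, `|dpartial s f x| <= M)].

Definition laplacian (f : 'rV[R]_n -> R) : 'rV[R]_n -> R :=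
  fun x => \sum_(i < n) partial i (partial i f) x.

Definition grad_dot (f g : 'rV[R]_n -> R) : 'rV[R]_n -> R :=
  fun x => \sum_(i < n) partial i f x * partial i g x.

End Defs.

Section Prob.
Context {d : measure_display} {T : measurableType d} {R : realType}.
Variable P : probability T R.

Definition Expect (h : T -> R) : R := \int[P]_w h w.
Definition Cov (h k : T -> R) : R :=
  Expect (fun w => h w * k w) - Expect h * Expect k.

Definition gen_sigma {n : nat} (X : T -> 'rV[R]_n) : set (set T) :=
  <<s [set E | exists (i : 'I_n) (A : set R),
                 measurable A /\ E = (fun w => X w 0 i) @^-1` A] >>.

Definition indep_rv {n m : nat} (X : T -> 'rV[R]_n) (W : T -> 'rV[R]_m) : Prop :=
  forall E F, gen_sigma X E -> gen_sigma W F ->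
    P (E `&` F) = (P E * P F)%E.

Definition random_vector {n : nat} (X : T -> 'rV[R]_n) : Prop :=
  forall i : 'I_n, measurable_fun setT (fun w => X w 0 i).

Definition VarW {n : nat} (X : T -> 'rV[R]_n) (fa fb : 'rV[R]_n -> R) : R :=
  Expect (fun w => grad_dot fa fb (X w)).

End Prob.

(* Main.v *)
(** Expand [f (X + s W)] in [s] to second order.  Since the third derivatives are
    bounded and [W] has all moments, the remainder is [s^3] times a function dominated,
    uniformly in [s], by a fixed square-integrable one; every term of the expansion is
    square integrable because [X] and [W] are independent.  Covariance is bilinear on
    square-integrable functions, so the covariance of two expansions is a polynomial in
    [s] plus [O(s^3)].  The order-one coefficient vanishes because [E W = 0]; as
    [E (W_i W_j)] is the Kronecker delta, the order-two coefficient is the Wasserstein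
    covariance plus the two Laplacian terms. *)

Require Import Defs.
From HB Require Import structures.
From mathcomp Require Import all_boot all_order all_algebra.
From mathcomp Require Import all_classical all_reals all_analysis.
From mathcomp Require Import measurable_realfun ring lra.
Set Implicit Arguments. Unset Strict Implicit. Unset Printing Implicit Defensive.
Import Order.TTheory GRing.Theory Num.Theory.
Import numFieldNormedType.Exports.
Local Open Scope classical_set_scope.
Local Open Scope ring_scope.

(** * Differentiability from continuous partial derivatives *)

Section DirectionalDerivative.
Context {R : realType} {V : normedModType R}.
Implicit Types (f : V -> R) (u v x : V).

(** Both difference quotients are the same function of [h], so one-variable tools such as the mean
    value theorem and the chain rule become available along lines. *)
Lemma is_derive_lineP f u x (t d : R) :
  is_derive t 1 (fun s : R => f (x + s *: u)) d <-> is_derive (x + t *: u) u f d.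
Proof.
have E : (fun h : R => h^-1 *: (((fun s : R => f (x + s *: u)) \o shift t) (h *: 1)
            - f (x + t *: u))) =
         (fun h : R => h^-1 *: ((f \o shift (x + t *: u)) (h *: u) - f (x + t *: u))).
  apply/funext => h /=; congr (_ *: (f _ - _)).
  rewrite scalerDl [in RHS]addrC -addrA; congr (_ + _).
  by rewrite addrC; congr (_ + _ *: _); rewrite /GRing.scale /= mulr1.
split => -[e <-].
- by split; [rewrite /derivable -E|rewrite /derive -E].
- by split; [rewrite /derivable E|rewrite /derive E].
Qed.

Lemma derivable_line f u x (t : R) : (forall y, derivable f y u) ->
  is_derive t 1 (fun s : R => f (x + s *: u)) ('D_u f (x + t *: u)).
Proof. by move=> fu; apply/is_derive_lineP; split. Qed.

Lemma line_within_continuous f u x (A : set R) : (forall y, derivable f y u) ->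
  {within A, continuous (fun s : R => f (x + s *: u))}.
Proof.
move=> fu; apply: continuous_subspaceT => t.
apply: differentiable_continuous; apply/derivable1_diffP.
by have [] := derivable_line x t fu.
Qed.

(** Directional derivatives are two-sided limits, so [h] may have either sign. Of the intermediate
    [s] only the size is kept, enough to send it to 0 with [h]. *)
Lemma line_MVT f u x (h : R) : (forall y, derivable f y u) ->
  exists2 s : R, `|s| <= `|h| & f (x + h *: u) - f x = h * 'D_u f (x + s *: u).
Proof.
move=> fu; have [h0|/ltW h0] := leP 0 h.
- have [s] := MVT_segment h0 (fun t _ => derivable_line x t fu)
                (@line_within_continuous f u x _ fu).
  rewrite in_itv /= => /andP[s0 sh]; rewrite scale0r addr0 subr0 mulrC => E.
  by exists s => //; rewrite !ger0_norm.
- have [s] := MVT_segment h0 (fun t _ => derivable_line x t fu)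
                (@line_within_continuous f u x _ fu).
  rewrite in_itv /= => /andP[sh s0]; rewrite scale0r addr0 sub0r mulrN mulrC => E.
  exists s; first by rewrite !ler0_norm // lerN2.
  by rewrite -opprB E opprK.
Qed.

(* Split [f (x + h (u + v)) - f x] at [x + h v]; the mean value theorem along [u] turns the
   first increment into a value of [D_u f] at a point tending to [x]. *)
Lemma is_derive_dirD f u v x (dv : R) :
  (forall y, derivable f y u) -> {for x, continuous (fun y => 'D_u f y)} ->
  is_derive x v f dv -> is_derive x (u + v) f ('D_u f x + dv).
Proof.
move=> fu cu [fv <-].
suff L : h^-1 *: ((f \o shift x) (h *: (u + v)) - f x) @[h --> 0^'] -->
         'D_u f x + 'D_v f x.
  by split; [apply/cvg_ex; exists ('D_u f x + 'D_v f x)|apply/cvg_lim].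
pose A (h : R) := h^-1 *: (f ((x + h *: v) + h *: u) - f (x + h *: v)).
have -> : (fun h : R => h^-1 *: ((f \o shift x) (h *: (u + v)) - f x)) =
          (fun h => A h + h^-1 *: ((f \o shift x) (h *: v) - f x)).
  apply/funext => h; rewrite /A /= [h *: (u + v)]scalerDr -[RHS]scalerDr.
  congr (_ *: _).
  rewrite (_ : h *: u + h *: v + x = x + h *: v + h *: u); last first.
    by rewrite addrC [h *: u + _]addrC addrA.
  by rewrite [h *: v + x]addrC addrA subrK.
apply: cvgD; last exact: fv.
apply/cvgrPdist_lt => e e0.
(* [q (s, h)] is the intermediate point of the mean value theorem. As [s] is only known to satisfy
   [|s| <= |h|], both coordinates are controlled by joint continuity at the origin. *)
pose q (z : R * R) := x + z.2 *: v + z.1 *: u.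
have qc : {for (0, 0), continuous q}.
  move=> /=; apply: cvgD; first apply: cvgD; first exact: cvg_cst.
  - by apply: cvgZr_tmp; exact: cvg_snd.
  - by apply: cvgZr_tmp; exact: cvg_fst.
have q0 : q (0, 0) = x by rewrite /q !scale0r !addr0.
have qx : q z @[z --> ((0 : R), (0 : R))] --> x by rewrite -q0; exact: qc.
have /cvgrPdist_lt/(_ e e0) := cvg_comp q _ qx cu.
move=> [[B1 B2] [/= /nbhs_ballP[d1 /= d10 S1] /nbhs_ballP[d2 /= d20 S2]] HB].
near=> h.
have hn0 : h != 0 by near: h; exact: nbhs_dnbhs_neq.
have [s sh E] := line_MVT (x + h *: v) h fu.
rewrite /A E /GRing.scale /= mulKf //.
apply: (HB (s, h)); split => /=.
- apply: S1; rewrite /ball /= sub0r normrN; apply: le_lt_trans sh _.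
  near: h; apply: dnbhs0_lt => //.
- apply: S2; rewrite /ball /= sub0r normrN.
  near: h; apply: dnbhs0_lt => //.
Unshelve. all: by end_near. Qed.

(** Along a line, scaling the direction by [c] is precomposition with [s => c * s], so the chain
    rule applies, including for [c = 0]. *)
Lemma is_derive_dirZ f u x (c d : R) :
  is_derive x u f d -> is_derive x (c *: u) f (c * d).
Proof.
move=> H.
have H0 : is_derive (x + 0 *: u) u f d by rewrite scale0r addr0.
have H1 : is_derive (x + 0 *: (c *: u)) (c *: u) f (c * d); last first.
  by move: H1; rewrite scale0r addr0.
apply/is_derive_lineP.
have -> : (fun s : R => f (x + s *: (c *: u))) = (fun s : R => f (x + s *: u)) \o (fun s => c * s).
  by apply/funext => s /=; rewrite scalerA mulrC.
rewrite mulrC; apply: is_derive1_comp; first by apply/is_derive_lineP; rewrite mulr0.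
apply: is_derive_eq; rewrite /GRing.scale /=; ring.
Qed.

Lemma is_derive_dir0 f x : is_derive x 0 f 0.
Proof.
have E : (fun h : R => h^-1 *: ((f \o shift x) (h *: (0 : V)) - f x)) = fun=> 0.
  by apply/funext => h /=; rewrite scaler0 add0r subrr scaler0.
split.
- by rewrite /derivable E; apply/cvg_ex; exists 0; exact: cvg_cst.
- by rewrite /derive E; exact: lim_cst.
Qed.

End DirectionalDerivative.

(** * Second-order Taylor bound in one variable *)

Section Taylor.
Context {R : realType}.

Lemma le_MVT0 {f df : R -> R} {K t : R} :
  (forall s : R, is_derive s 1 f (df s)) -> 0 <= t ->
  (forall s, 0 <= s <= t -> `|df s| <= K) -> `|f t - f 0| <= K * t.
Proof.
move=> fd t0 dfK.
have fc : {within `[0, t], continuous f}.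
  apply: continuous_subspaceT => s.
  by apply: differentiable_continuous; apply/derivable1_diffP; have [] := fd s.
have [c] := MVT_segment t0 (fun s _ => fd s) fc.
rewrite in_itv /= => ct ->; rewrite normrM subr0 (ger0_norm t0) ler_wpM2r //.
exact: dfK.
Qed.

(** Three uses of the mean value inequality, on [f2], then [f1], then [f], each after subtracting
    the polynomial part already known. Each use costs a factor [t]; the sharp constant 1/6 is given
    up. *)
Lemma taylor2_bound {f f1 f2 f3 : R -> R} {K t : R} :
  (forall s : R, is_derive s 1 f (f1 s)) -> (forall s : R, is_derive s 1 f1 (f2 s)) ->
  (forall s : R, is_derive s 1 f2 (f3 s)) -> (forall s, `|f3 s| <= K) -> 0 <= t ->
  `|f t - (f 0 + t * f1 0 + t ^+ 2 * (2^-1 * f2 0))| <= t ^+ 3 * K.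
Proof.
move=> d1 d2 d3 f3K t0.
have K0 : 0 <= K by apply: le_trans (f3K 0).
have B2 s : 0 <= s -> `|f2 s - f2 0| <= K * s.
  by move=> s0; apply: (le_MVT0 d3).
have d2' (s : R) : is_derive s 1 (fun s => f1 s - s * f2 0) (f2 s - f2 0).
  have := d2 s => ?; apply: is_derive_eq; rewrite /GRing.scale /=; ring.
have B1 s : 0 <= s -> `|f1 s - s * f2 0 - f1 0| <= K * s * s.
  move=> s0; have := @le_MVT0 _ _ (K * s) s d2' s0.
  rewrite mul0r subr0; apply => r /andP[r0 rs].
  by apply: (le_trans (B2 r r0)); rewrite ler_wpM2l.
have d1' (s : R) : is_derive s 1 (fun s => f s - s * f1 0 - s ^+ 2 * (2^-1 * f2 0))
               (f1 s - s * f2 0 - f1 0).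
  have := d1 s => ?; apply: is_derive_eq; rewrite /GRing.scale /=; by field.
have := @le_MVT0 _ _ (K * t * t) t d1' t0.
rewrite mul0r expr0n /= mul0r !subr0.
rewrite (_ : f t - (f 0 + _ + _) = f t - t * f1 0 - t ^+ 2 * (2^-1 * f2 0) - f 0); last ring.
rewrite (_ : t ^+ 3 * K = K * t * t * t); last ring.
apply => r /andP[r0 rt]; apply: (le_trans (B1 r r0)).
by rewrite -!mulrA ler_wpM2l // ler_pM.
Qed.

End Taylor.

(** * Taylor expansion along lines in several variables *)

Section DPartial.
Context {R : realType} {n : nat}.
Implicit Types (f : 'rV[R]_n -> R) (x w : 'rV[R]_n).

(** Induction over the coordinates of [w]: each adds a direction [w 0 i *: basis_vec i] along which
    the derivative exists everywhere and is continuous, as [is_derive_dirD] asks of the added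
    direction. *)
Lemma is_derive_partials f x w :
  (forall i y, derivable f y (basis_vec i)) -> (forall i, continuous (partial i f)) ->
  is_derive x w f (\sum_(i < n) w 0 i * partial i f x).
Proof.
move=> fd fc; rewrite {1}(row_sum_delta w).
elim: (index_enum _) => [|i s IH]; first by rewrite !big_nil; exact: is_derive_dir0.
rewrite !big_cons.
have P y : is_derive y (w 0 i *: basis_vec i) f (w 0 i * partial i f y).
  by apply: is_derive_dirZ; split.
have E : (fun y => 'D_(w 0 i *: basis_vec i) f y) = (fun y => w 0 i * partial i f y).
  by apply/funext => y; have [] := P y.
have := @is_derive_dirD _ _ f (w 0 i *: basis_vec i) _ x _ _ _ IH.
rewrite (_ : 'D_(w 0 i *: basis_vec i) f x = w 0 i * partial i f x); last by have [] := P x.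
apply; first by move=> y; have [] := P y.
rewrite E; apply: continuousM; [exact: cst_continuous|exact: fc].
Qed.

Lemma C3_is_derive_line f (l : seq 'I_n) x w (t : R) :
  C3_bounded_third f -> (size l < 3)%N ->
  is_derive t 1 (fun s : R => dpartial l f (x + s *: w))
    (\sum_(i < n) w 0 i * dpartial (i :: l) f (x + t *: w)).
Proof.
move=> [fd fc _] l3; apply/is_derive_lineP.
by apply: is_derive_partials => [i y|i]; [exact: fd|exact: (fc (i :: l))].
Qed.

(* Coefficients of [t] and [t^2] in the expansion of [f (x + t w)]. *)
Definition taylor1 f x w : R := \sum_(i < n) w 0 i * dpartial [:: i] f x.

Definition taylor2 f x w : R :=
  2^-1 * \sum_(i < n) w 0 i * \sum_(j < n) w 0 j * dpartial [:: j; i] f x.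

(** On the line through [x] along [w] the third derivative is a cubic form in [w] with bounded
    coefficients. The resulting bound does not depend on [x], so later only moments of the noise are
    needed to control it. *)
Lemma C3_taylor f : C3_bounded_third f ->
  exists M : seq 'I_n -> R, forall x w (t : R), 0 <= t ->
  `|f (x + t *: w) - (f x + t * taylor1 f x w + t ^+ 2 * taylor2 f x w)|
    <= t ^+ 3 * \sum_(i < n) `|w 0 i| * \sum_(j < n) `|w 0 j| *
          \sum_(k < n) `|w 0 k| * M [:: k; j; i].
Proof.
move=> fC; have [_ _ f3] := fC.
have /choice[M fM] : forall l : seq 'I_n, exists M : R, size l = 3%N -> forall x, `|dpartial l f x| <= M.
  (* [choice] asks for a bound for every list; those of length other than three receive the dummy
     value 0. *)
  move=> l; have [l3|l3] := eqVneq (size l) 3%N; last by exists 0 => /eqP; rewrite (negbTE l3).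
  by have [M] := f3 _ l3; exists M.
exists M => x w t t0.
have D (l : seq _) (s : R) : (size l < 3)%N -> is_derive s 1 (fun s : R => dpartial l f (x + s *: w)) _ :=
  @C3_is_derive_line f l x w s fC.
have D1 (s : R) := D [::] s isT.
have D2 (s : R) : is_derive s 1 (fun s : R => \sum_(i < n) w 0 i * dpartial [:: i] f (x + s *: w))
   (\sum_(i < n) w 0 i * \sum_(j < n) w 0 j * dpartial [:: j; i] f (x + s *: w)).
  rewrite -fct_sumE; apply: is_derive_sum => i.
  by apply: is_deriveZ; exact: (D [:: i]).
have D3 (s : R) : is_derive s 1 (fun s : R => \sum_(i < n) w 0 i * \sum_(j < n) w 0 j * dpartial [:: j; i] f (x + s *: w))
   (\sum_(i < n) w 0 i * \sum_(j < n) w 0 j * \sum_(k < n) w 0 k * dpartial [:: k; j; i] f (x + s *: w)).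
  rewrite -fct_sumE; apply: is_derive_sum => i; apply: is_deriveZ.
  rewrite -fct_sumE; apply: is_derive_sum => j; apply: is_deriveZ.
  exact: (D [:: j; i]).
have := taylor2_bound D1 D2 D3 _ t0; rewrite !scale0r !addr0; apply => s.
apply: (le_trans (ler_norm_sum _ _ _)); apply: ler_sum => i _; rewrite normrM ler_wpM2l //.
apply: (le_trans (ler_norm_sum _ _ _)); apply: ler_sum => j _; rewrite normrM ler_wpM2l //.
apply: (le_trans (ler_norm_sum _ _ _)); apply: ler_sum => k _; rewrite normrM ler_wpM2l //.
exact: fM.
Qed.

End DPartial.

(** * Measurability and independence *)

(* [X] is the limit of its roundings to the grids of mesh [1/(k+1)]; the rounded vector takes
   countably many values, so no continuity is needed for its image to be measurable. *)
Lemma continuous_random_vector {d : measure_display} {T : measurableType d} {R : realType}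
    {n : nat} (X : T -> 'rV[R]_n) (f : 'rV[R]_n -> R) :
  random_vector X -> continuous f -> measurable_fun setT (fun w => f (X w)).
Proof.
move=> mX cf.
pose fl (k : nat) (w : T) (i : 'I_n) : int := Num.floor (X w 0 i * k.+1%:R).
pose grid (k : nat) (z : {ffun 'I_n -> int}) : 'rV[R]_n := \row_i ((z i)%:~R / k.+1%:R).
pose Xk k w := grid k [ffun i => fl k w i].
apply: (@measurable_fun_cvg _ _ _ _ (fun k w => f (Xk k w))).
- move=> k _ A mA; rewrite setTI.
  (* The preimage is the union of the cells whose grid point is sent into [A] by [f]; a cell is a
     finite intersection of half-open slabs. *)
  have -> : (fun w => f (Xk k w)) @^-1` A = \bigcup_(z : {ffun 'I_n -> int})
      (if `[< A (f (grid k z)) >] then \bigcap_(i : 'I_n) ((fun w => X w 0 i) @^-1`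
          `[(z i)%:~R / k.+1%:R, (z i + 1)%:~R / k.+1%:R[%classic) else set0).
    apply/seteqP; split => [w Aw|w [z _]] /=.
    + exists [ffun i => fl k w i] => //; rewrite asboolT // => i _ /=.
      rewrite ffunE in_itv /= ler_pdivrMr // ltr_pdivlMr //.
      exact: floor_itv.
    + case: asboolP => // Az H; rewrite /Xk (_ : [ffun i => fl k w i] = z) //.
      apply/ffunP => i; rewrite ffunE; apply/eqP; rewrite floor_eq.
      by have := H i Logic.I; rewrite /= in_itv /= ler_pdivrMr // ltr_pdivlMr.
  apply: countable_bigcupT_measurable => [|z]; [exact: countableP|case: ifP] => _; last exact: measurable0.
  apply: fin_bigcap_measurable => [|i _]; first exact: finite_finset.
  rewrite -[X in measurable X]setTI; exact: (mX i measurableT _ (measurable_itv _)).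
(* Rounding down moves each coordinate by at most [1/(k+1)], uniformly over the coordinates. *)
- move=> w _; suff L : Xk k w @[k --> \oo] --> X w by exact: (cvg_comp _ _ L (cf (X w))).
  apply/cvg_ballP => e e0.
  have := near_infty_natSinv_lt (PosNum e0); apply: filterS => k /= ke; split => // i j.
  rewrite /ball /= mxE ffunE ord1.
  have /andP[] := floor_itv (X w 0 j * k.+1%:R).
  rewrite -/(fl k w j) -ler_pdivrMr // -ltr_pdivlMr // => a b.
  rewrite ger0_norm ?subr_ge0 //; apply: le_lt_trans ke.
  by rewrite lerBlDl (le_trans (ltW b)) // intrD mulrDl mul1r.
Qed.

Section IndependentProduct.
Context {d : measure_display} {T : measurableType d} {R : realType} (P : probability T R).

(* The joint law of [(F, G)] is the product of the marginal laws, so Fubini applies. *)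
Lemma integral_indep_prod (F G : T -> R) :
  measurable_fun setT F -> measurable_fun setT G ->
  (forall A B : set R, measurable A -> measurable B ->
     P ((F @^-1` A) `&` (G @^-1` B)) = (P (F @^-1` A) * P (G @^-1` B))%E) ->
  P.-integrable setT (EFin \o F) -> P.-integrable setT (EFin \o G) ->
  P.-integrable setT (fun w => (F w * G w)%:E) /\
  Expect P (fun w => F w * G w) = Expect P F * Expect P G.
Proof.
move=> mF mG ind iF iG.
pose F' : {RV P >-> R} := HB.pack_for {RV P >-> R} F (isMeasurableFun.Build _ _ _ _ F mF).
pose G' : {RV P >-> R} := HB.pack_for {RV P >-> R} G (isMeasurableFun.Build _ _ _ _ G mG).
pose FG w := (F w, G w).
have mFG : measurable_fun setT FG by exact: measurable_fun_pair.
pose FG' : {RV P >-> (R * R)%type} := HB.pack_for {RV P >-> (R * R)%type} FG (isMeasurableFun.Build _ _ _ _ FG mFG).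
pose m1 : probability _ R := distribution P F'; pose m2 : probability _ R := distribution P G'.
have E A : measurable A -> (m1 \x m2)%E A = distribution P FG' A.
  by apply: product_measure_unique => A1 A2 mA1 mA2; exact: ind.
pose xy (z : R * R) := (z.1 * z.2)%:E.
have mxy : measurable_fun setT xy.
  by apply/measurable_EFinP; apply: measurable_funM; [exact: measurable_fst|exact: measurable_snd].
have mabs : measurable_fun setT (fun x : R => `|x|%:E).
  by apply/measurable_EFinP; exact: normr_measurable.
(* By Tonelli this integral is the product of the first absolute moments of [F] and [G], both
   finite. *)
have ifin : (\int[m1 \x m2]_z `|xy z| < +oo)%E.
  rewrite fubini_tonelli1 //; last exact: measurableT_comp.
  rewrite /fubini_F /xy /=.
  rewrite (eq_integral (fun x : R => `|x|%:E * \int[m2]_y `|y|%:E))%E => [|x _]; last first.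
    under eq_integral do rewrite normrM EFinM.
    by rewrite ge0_integralZl.
  rewrite ge0_integralZr //; last by apply: integral_ge0 => x _; rewrite lee_fin.
  rewrite !ge0_integral_distribution //.
  move: iF iG => /integrableP[_ iF] /integrableP[_ iG].
  have H0 (h : T -> R) : (0 <= \int[P]_w `|h w|%:E)%E by apply: integral_ge0 => w _; rewrite lee_fin.
  by apply: lte_mul_pinfty => //; [exact: H0|rewrite ge0_fin_numE //; exact: H0].
have ixy : (m1 \x m2)%E.-integrable setT xy by apply/integrableP.
have iFG : P.-integrable setT (fun w => (F w * G w)%:E).
  apply/integrableP; split; first by apply/measurable_EFinP; exact: measurable_funM.
  have := ifin; rewrite (eq_measure_integral (distribution P FG')) => [|A mA _]; last exact: E.
  by rewrite ge0_integral_distribution //; exact: measurableT_comp.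
split=> //.
have EE := integral12_prod_meas1 ixy.
rewrite (eq_measure_integral (distribution P FG')) in EE; last by move=> A mA _; exact: E.
rewrite /Expect /Rintegral -fineM ?integrable_fin_num //; congr fine.
rewrite -(@integral_distribution _ _ _ _ _ P FG' xy mxy iFG) -EE /fubini_F /xy /=.
have IG : (\int[m2]_y y%:E = \int[P]_x (G x)%:E)%E by rewrite integral_distribution.
have IF : (\int[m1]_y y%:E = \int[P]_x (F x)%:E)%E by rewrite integral_distribution.
have mE : measurable_fun setT (fun y : R => y%:E) by exact/measurable_EFinP.
have i2 : m2.-integrable setT (fun y : R => y%:E) by exact: (integrable_pushforward mG mE iG measurableT).
have i1 : m1.-integrable setT (fun y : R => y%:E) by exact: (integrable_pushforward mF mE iF measurableT).
rewrite (eq_integral (fun x : R => x%:E * (fine (\int[P]_w (G w)%:E))%:E))%E => [|x _]; last first.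
  under eq_integral do rewrite EFinM.
  by rewrite integralZl // IG fineK // integrable_fin_num.
by rewrite integralZr // IF fineK // integrable_fin_num.
Qed.

(* Apply [continuous_random_vector] over the sigma-algebra generated by the vector itself. *)
Lemma indep_rv_comp {n m : nat} (X : T -> 'rV[R]_n) (W : T -> 'rV[R]_m) f g (A B : set R) :
  indep_rv P X W -> continuous f -> continuous g -> measurable A -> measurable B ->
  P (((fun w => f (X w)) @^-1` A) `&` ((fun w => g (W w)) @^-1` B)) =
  (P ((fun w => f (X w)) @^-1` A) * P ((fun w => g (W w)) @^-1` B))%E.
Proof.
move=> ind cf cg mA mB.
have K k (Y : T -> 'rV[R]_k) h (C : set R) : continuous h -> measurable C ->
    gen_sigma Y ((fun w => h (Y w)) @^-1` C).
  move=> ch mC.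
  pose T' := g_sigma_algebraType
    [set E | exists (i : 'I_k) (A : set R), measurable A /\ E = (fun w => Y w 0 i) @^-1` A].
  have mY : random_vector (Y : T' -> _).
    move=> i _ D mD; rewrite setTI; apply: sub_sigma_algebra; by exists i, D.
  by have := continuous_random_vector mY ch measurableT mC; rewrite setTI.
by apply: ind; exact: K.
Qed.

Lemma indep_rv_expectM {n m : nat} (X : T -> 'rV[R]_n) (W : T -> 'rV[R]_m) f g :
  random_vector X -> random_vector W -> indep_rv P X W -> continuous f -> continuous g ->
  P.-integrable setT (fun w => (f (X w))%:E) -> P.-integrable setT (fun w => (g (W w))%:E) ->
  P.-integrable setT (fun w => (f (X w) * g (W w))%:E) /\
  Expect P (fun w => f (X w) * g (W w)) =
    Expect P (fun w => f (X w)) * Expect P (fun w => g (W w)).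
Proof.
move=> mX mW ind cf cg iF iG; apply: integral_indep_prod => //.
- exact: continuous_random_vector.
- exact: continuous_random_vector.
- by move=> A B mA mB; exact: indep_rv_comp.
Qed.

End IndependentProduct.

(** * Covariance of square-integrable functions *)

Section SquareIntegrable.
Context {d : measure_display} {T : measurableType d} {R : realType} (P : probability T R).
Implicit Types h k : T -> R.

(** Measurability of [h] is stated apart because that of [h ^+ 2] does not imply it. *)
Definition square_integrable h :=
  measurable_fun setT h /\ P.-integrable setT (fun w => (h w ^+ 2)%:E).

Lemma le_integrable_fin h k : measurable_fun setT h -> (forall w, `|h w| <= k w) ->
  P.-integrable setT (fun w => (k w)%:E) -> P.-integrable setT (fun w => (h w)%:E).
Proof.
move=> mh hk; apply: le_integrable => //; first exact/measurable_EFinP.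
by move=> w _ /=; rewrite lee_fin (le_trans (hk w)) // ler_norm.
Qed.

Lemma integrableD_fin h k : P.-integrable setT (fun w => (h w)%:E) ->
  P.-integrable setT (fun w => (k w)%:E) -> P.-integrable setT (fun w => (h w + k w)%:E).
Proof. by move=> ih ik; have := integrableD measurableT ih ik. Qed.

Lemma integrableZ_fin (c : R) h : P.-integrable setT (fun w => (h w)%:E) ->
  P.-integrable setT (fun w => (c * h w)%:E).
Proof. by move=> ih; have := integrableZl measurableT c ih. Qed.

Lemma square_integrable_le h k : measurable_fun setT h -> (forall w, `|h w| <= `|k w|) ->
  square_integrable k -> square_integrable h.
Proof.
move=> mh hk [mk ik]; split => //; apply: le_integrable_fin ik.
  exact: measurable_funX.
by move=> w; rewrite normrX -[leRHS]real_normK ?num_real // lerXn2r // nnegrE.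
Qed.

Lemma square_integrable_cst (c : R) : square_integrable (fun=> c).
Proof. by split; [exact: measurable_cst|exact: (finite_measure_integrable_cst P (c ^+ 2))]. Qed.

Lemma square_integrableZ (c : R) h : square_integrable h -> square_integrable (fun w => c * h w).
Proof.
move=> [mh ih]; split; first exact: measurable_funM.
under eq_fun do rewrite exprMn; exact: integrableZ_fin.
Qed.

Lemma square_integrableD h k : square_integrable h -> square_integrable k ->
  square_integrable (fun w => h w + k w).
Proof.
move=> [mh ih] [mk ik]; split; first exact: measurable_funD.
apply: (@le_integrable_fin _ (fun w => 2 * (h w ^+ 2 + k w ^+ 2))).
- by apply: measurable_funX; exact: measurable_funD.
- move=> w; rewrite ger0_norm ?sqr_ge0 //.
  by rewrite -subr_ge0 (_ : _ - _ = (h w - k w) ^+ 2) ?sqr_ge0 //; ring.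
- by apply: integrableZ_fin; exact: integrableD_fin.
Qed.

Lemma square_integrable_sum (I : Type) (s : seq I) (h : I -> T -> R) :
  (forall i, square_integrable (h i)) -> square_integrable (fun w => \sum_(i <- s) h i w).
Proof.
move=> sh; elim: s => [|i s IH].
  by under eq_fun do rewrite big_nil; exact: square_integrable_cst.
by under eq_fun do rewrite big_cons; exact: square_integrableD.
Qed.

Lemma square_integrableM h k : square_integrable h -> square_integrable k ->
  P.-integrable setT (fun w => (h w * k w)%:E).
Proof.
move=> [mh ih] [mk ik].
apply: (@le_integrable_fin _ (fun w => h w ^+ 2 + k w ^+ 2)).
- exact: measurable_funM.
- move=> w; rewrite normrM -(real_normK (num_real (h w))) -(real_normK (num_real (k w))).
  have := sqr_ge0 (`|h w| - `|k w|); have := sqr_ge0 (`|h w| + `|k w|); nra.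
- exact: integrableD_fin.
Qed.

Lemma square_integrable_integrable h : square_integrable h -> P.-integrable setT (fun w => (h w)%:E).
Proof.
move=> sh; have := square_integrableM sh (square_integrable_cst 1).
by under eq_fun do rewrite mulr1.
Qed.

Lemma square_integrable_norm h : square_integrable h -> square_integrable (fun w => `|h w|).
Proof.
move=> sh; apply: square_integrable_le (sh) => [|w]; last by rewrite normr_id.
by apply: measurableT_comp => //; exact: sh.1.
Qed.

Lemma ExpectD h k : P.-integrable setT (fun w => (h w)%:E) -> P.-integrable setT (fun w => (k w)%:E) ->
  Expect P (fun w => h w + k w) = Expect P h + Expect P k.
Proof. exact: RintegralD. Qed.

Lemma ExpectZ (c : R) h : P.-integrable setT (fun w => (h w)%:E) ->
  Expect P (fun w => c * h w) = c * Expect P h.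
Proof. by move=> ih; rewrite /Expect RintegralZl. Qed.

Lemma CovC h k : Cov P h k = Cov P k h.
Proof.
rewrite /Cov [Expect P h * _]mulrC; congr (Expect P _ - _).
by apply/funext => w; rewrite mulrC.
Qed.

Lemma CovDl h1 h2 k : square_integrable h1 -> square_integrable h2 -> square_integrable k ->
  Cov P (fun w => h1 w + h2 w) k = Cov P h1 k + Cov P h2 k.
Proof.
move=> s1 s2 sk; rewrite /Cov.
under [X in Expect P X - _]eq_fun do rewrite mulrDl.
rewrite ExpectD ?ExpectD; try exact: square_integrable_integrable; try exact: square_integrableM.
ring.
Qed.

Lemma CovZl (c : R) h k : square_integrable h -> square_integrable k ->
  Cov P (fun w => c * h w) k = c * Cov P h k.
Proof.
move=> sh sk; rewrite /Cov.
under [X in Expect P X - _]eq_fun do rewrite -mulrA.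
rewrite !ExpectZ; [|exact: square_integrable_integrable|exact: square_integrableM].
ring.
Qed.

Lemma Cov_cstr h (c : R) : square_integrable h -> Cov P h (fun=> c) = 0.
Proof.
move=> sh; rewrite /Cov.
under [X in Expect P X - _]eq_fun do rewrite mulrC.
rewrite ExpectZ; last exact: square_integrable_integrable.
rewrite /Expect Rintegral_cst // (congr1 fine (probability_setT P)) /=; ring.
Qed.

Lemma Cov_suml (I : Type) (s : seq I) (h : I -> T -> R) k :
  (forall i, square_integrable (h i)) -> square_integrable k ->
  Cov P (fun w => \sum_(i <- s) h i w) k = \sum_(i <- s) Cov P (h i) k.
Proof.
move=> sh sk; elim: s => [|i s IH].
  rewrite big_nil; under [X in Cov P X]eq_fun do rewrite big_nil.
  by rewrite CovC Cov_cstr.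
rewrite big_cons -IH; under [X in Cov P X]eq_fun do rewrite big_cons.
by rewrite CovDl //; exact: square_integrable_sum.
Qed.

Lemma Cov_sumr (I : Type) (s : seq I) h (k : I -> T -> R) :
  square_integrable h -> (forall i, square_integrable (k i)) ->
  Cov P h (fun w => \sum_(i <- s) k i w) = \sum_(i <- s) Cov P h (k i).
Proof. by move=> sh sk; rewrite CovC Cov_suml //; apply: eq_bigr => i _; exact: CovC. Qed.

(** Covariance is not monotone under domination, but this majorant of its absolute value is; it
    yields constants independent of [s] for remainders that depend on [s]. *)
Definition cov_bound h k : R :=
  Expect P (fun w => `|h w| * `|k w|) + Expect P (fun w => `|h w|) * Expect P (fun w => `|k w|).

Lemma le_norm_Expect h k : measurable_fun setT h -> (forall w, `|h w| <= k w) ->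
  P.-integrable setT (fun w => (k w)%:E) -> `|Expect P h| <= Expect P k.
Proof.
move=> mh hk ik; have ih := le_integrable_fin mh hk ik.
apply: (le_trans (le_normr_Rintegral measurableT ih)).
apply: le_Rintegral => //; exact: (integrable_norm ih).
Qed.

Lemma norm_Cov_le h k h' k' : measurable_fun setT h -> measurable_fun setT k ->
  (forall w, `|h w| <= `|h' w|) -> (forall w, `|k w| <= `|k' w|) ->
  square_integrable h' -> square_integrable k' -> `|Cov P h k| <= cov_bound h' k'.
Proof.
move=> mh mk hh' kk' sh sk; apply: (le_trans (ler_normB _ _)); apply: lerD.
  apply: le_norm_Expect.
  - exact: measurable_funM.
  - by move=> w; rewrite normrM ler_pM.
  - by apply: square_integrableM; exact: square_integrable_norm.
rewrite normrM ler_pM //; apply: le_norm_Expect => //;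
  by apply: square_integrable_integrable; exact: square_integrable_norm.
Qed.

(** In use [h3] is the Taylor remainder divided by [s ^+ 3] and itself depends on [s], which makes
    the expansion an exact identity. *)
Definition cubic (s : R) (h0 h1 h2 h3 : T -> R) : T -> R :=
  fun w => h0 w + s * h1 w + s ^+ 2 * h2 w + s ^+ 3 * h3 w.

Lemma square_integrable_cubic s h0 h1 h2 h3 : square_integrable h0 -> square_integrable h1 ->
  square_integrable h2 -> square_integrable h3 -> square_integrable (cubic s h0 h1 h2 h3).
Proof.
by move=> s0 s1 s2 s3; do ?[apply: square_integrableD|apply: square_integrableZ].
Qed.

Lemma Cov_cubicl s h0 h1 h2 h3 k : square_integrable h0 -> square_integrable h1 ->
  square_integrable h2 -> square_integrable h3 -> square_integrable k ->
  Cov P (cubic s h0 h1 h2 h3) k =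
  Cov P h0 k + s * Cov P h1 k + s ^+ 2 * Cov P h2 k + s ^+ 3 * Cov P h3 k.
Proof.
move=> s0 s1 s2 s3 sk.
by rewrite /cubic !CovDl ?CovZl //; do ?[apply: square_integrableD|apply: square_integrableZ].
Qed.

End SquareIntegrable.

(** * Covariance of two expansions with a cubic remainder *)

Section CovExpansion.
Context {d : measure_display} {T : measurableType d} {R : realType} (P : probability T R).

Lemma cvg_at_right0_linear (g : R -> R) (L K : R) :
  (forall s : R, 0 < s <= 1 -> `|g s - L| <= s * K) -> g s @[s --> 0^'+] --> L.
Proof.
move=> H.
have K0 : 0 <= K by have := H 1; rewrite ltr01 lexx mul1r => /(_ isT); apply: le_trans.
apply/cvgrPdist_lt => e e0; near=> s.
have s0 : 0 < s by near: s; exact: nbhs_right_gt.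
have s1 : s < 1 by near: s; exact: nbhs_right_lt.
(* [K + 1] replaces [K] because [K] may be 0. *)
have se : s < e / (K + 1).
  by near: s; apply: nbhs_right_lt; rewrite divr_gt0 // ltr_wpDl.
rewrite distrC; apply: (le_lt_trans (H s _)); first by rewrite s0 ltW.
apply: (@le_lt_trans _ _ (s * (K + 1))); first by rewrite ler_wpM2l ?lerDl // ltW.
by rewrite -ltr_pdivlMr // ltr_wpDl.
Unshelve. all: by end_near. Qed.

(** Bilinearity gives sixteen terms: the one of order 0 is subtracted, the two of order 1 vanish by
    hypothesis, the three of order 2 form the limit, and the other ten carry at least [s ^+ 3]. *)
Lemma cvg_Cov_cubic (f0 f1 f2 fH g0 g1 g2 gH : T -> R) (F G : R -> T -> R) :
  square_integrable P f0 -> square_integrable P f1 -> square_integrable P f2 -> square_integrable P fH ->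
  square_integrable P g0 -> square_integrable P g1 -> square_integrable P g2 -> square_integrable P gH ->
  (forall s, measurable_fun setT (F s)) -> (forall s, measurable_fun setT (G s)) ->
  (forall s w, 0 < s -> `|F s w - (f0 w + s * f1 w + s ^+ 2 * f2 w)| <= s ^+ 3 * fH w) ->
  (forall s w, 0 < s -> `|G s w - (g0 w + s * g1 w + s ^+ 2 * g2 w)| <= s ^+ 3 * gH w) ->
  Cov P f0 g1 = 0 -> Cov P f1 g0 = 0 ->
  (Cov P (F s) (G s) - Cov P f0 g0) / s ^+ 2 @[s --> 0^'+] -->
    Cov P f1 g1 + (Cov P f0 g2 + Cov P f2 g0).
Proof.
move=> Sf0 Sf1 Sf2 SfH Sg0 Sg1 Sg2 SgH mF mG FH GH C01 C10.
pose rem (H : R -> T -> R) (h0 h1 h2 : T -> R) (s : R) (w : T) : R :=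
  s^-1 ^+ 3 * (H s w - (h0 w + s * h1 w + s ^+ 2 * h2 w)).
have remP (H : R -> T -> R) (h0 h1 h2 hH : T -> R) :
    square_integrable P h0 -> square_integrable P h1 -> square_integrable P h2 ->
    square_integrable P hH -> (forall s, measurable_fun setT (H s)) ->
    (forall s w, 0 < s -> `|H s w - (h0 w + s * h1 w + s ^+ 2 * h2 w)| <= s ^+ 3 * hH w) ->
    forall s, 0 < s -> [/\ H s = cubic s h0 h1 h2 (rem H h0 h1 h2 s),
      square_integrable P (rem H h0 h1 h2 s) & forall w, `|rem H h0 h1 h2 s w| <= `|hH w|].
  move=> S0 S1 S2 SH mH HH s s0.
  have le w : `|rem H h0 h1 h2 s w| <= `|hH w|.
    rewrite /rem normrM normrX ger0_norm; last by rewrite invr_ge0 ltW.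
    rewrite exprVn ler_pdivrMl ?exprn_gt0 //.
    apply: (le_trans (HH s w s0)).
    by rewrite ler_pM2l ?exprn_gt0 // ler_norm.
  split => //.
  - by apply/funext => w; rewrite /cubic /rem; field; rewrite gt_eqF.
  - apply: square_integrable_le SH => //.
    apply: measurable_funM => //; apply: measurable_funB => //.
    by apply: measurable_funD; [apply: measurable_funD|]; rewrite ?S0.1 //;
      [exact: S0.1|apply: measurable_funM => //; exact: S1.1|apply: measurable_funM => //; exact: S2.1].
have remF := remP F f0 f1 f2 fH Sf0 Sf1 Sf2 SfH mF FH.
have remG := remP G g0 g1 g2 gH Sg0 Sg1 Sg2 SgH mG GH.
pose b := cov_bound P.
(* One majorant for each of the ten higher-order terms, with every normalised remainder replaced by
   its dominating function [fH] or [gH]. *)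
pose K := b f1 g2 + b f2 g1 + b f2 g2 + b f0 gH + b f1 gH + b f2 gH + b fH g0 + b fH g1 + b fH g2 + b fH gH.
apply: (@cvg_at_right0_linear _ _ K) => s /andP[s0 s1].
have [Fs SrF leF] := remF s s0; have [Gs SrG leG] := remG s s0.
move: Fs SrF leF Gs SrG leG; set rF := rem F _ _ _ _; set rG := rem G _ _ _ _.
move=> Fs SrF leF Gs SrG leG.
rewrite Fs Gs Cov_cubicl //; last exact: square_integrable_cubic.
(* Symmetry brings the second expansion to the left, where it can be expanded; the later swaps
   restore the order. *)
rewrite ![Cov P _ (cubic s g0 _ _ _)]CovC !Cov_cubicl // ![Cov P _ f0]CovC ![Cov P _ f1]CovC ![Cov P _ f2]CovC ![Cov P _ rF]CovC.
rewrite C01 C10.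
(* Since [s <= 1], surplus powers of [s] are bounded by 1. *)
have B (h k h' k' : T -> R) (i : nat) : square_integrable P h -> square_integrable P k ->
    square_integrable P h' -> square_integrable P k' ->
    (forall w, `|h w| <= `|h' w|) -> (forall w, `|k w| <= `|k' w|) ->
    `|s ^+ i * Cov P h k| <= b h' k'.
  move=> Sh Sk Sh' Sk' hh kk.
  rewrite normrM normrX (ger0_norm (ltW s0)); apply: (@le_trans _ _ (1 * `|Cov P h k|)).
    by rewrite ler_wpM2r // exprn_ile1 // ltW.
  by rewrite mul1r; apply: norm_Cov_le => //; [exact: Sh.1|exact: Sk.1].
rewrite (_ : _ - _ = s * (s ^+ 0 * Cov P f1 g2 + s ^+ 0 * Cov P f2 g1 + s ^+ 1 * Cov P f2 g2
   + s ^+ 0 * Cov P f0 rG + s ^+ 1 * Cov P f1 rG + s ^+ 2 * Cov P f2 rG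
   + s ^+ 0 * Cov P rF g0 + s ^+ 1 * Cov P rF g1 + s ^+ 2 * Cov P rF g2 + s ^+ 3 * Cov P rF rG)); last first.
  by field; rewrite gt_eqF.
rewrite normrM (ger0_norm (ltW s0)); apply: ler_wpM2l; first exact: ltW.
by do 9 (apply: (le_trans (ler_normD _ _)); apply: lerD; last exact: B); exact: B.
Qed.

End CovExpansion.

(** * Functions with moments of all orders *)

Section AllMoments.
Context {d : measure_display} {T : measurableType d} {R : realType} (P : probability T R).
Implicit Types h k : T -> R.

(** Unlike square integrability, this class is closed under products, so polynomials in the noise
    coordinates and their absolute values stay in it. *)
Definition all_moments h :=
  measurable_fun setT h /\ forall m : nat, P.-integrable setT (fun w => (`|h w| ^+ m)%:E).

Lemma all_moments_cst (c : R) : all_moments (fun=> c).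
Proof.
by split=> [|m]; [exact: measurable_cst|exact: (finite_measure_integrable_cst P (`|c| ^+ m))].
Qed.

Lemma all_moments_norm h : all_moments h -> all_moments (fun w => `|h w|).
Proof.
move=> [mh ih]; split=> [|m]; first exact: measurableT_comp.
by under eq_fun do rewrite normr_id; exact: ih.
Qed.

(** Moments of order [m] of the product are controlled by moments of order [2 m] of the factors,
    through [a b <= a^2 + b^2] for nonnegative [a], [b]. *)
Lemma all_momentsM h k : all_moments h -> all_moments k -> all_moments (fun w => h w * k w).
Proof.
move=> [mh ih] [mk ik]; split=> [|m]; first exact: measurable_funM.
apply: (@le_integrable_fin _ _ _ _ _ (fun w => `|h w| ^+ (m * 2) + `|k w| ^+ (m * 2))).
- by apply: measurable_funX; apply: measurableT_comp => //; exact: measurable_funM.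
- move=> w; rewrite normrX normr_id normrM exprMn !exprM.
  have := exprn_ge0 m (normr_ge0 (h w)); have := exprn_ge0 m (normr_ge0 (k w)).
  have := sqr_ge0 (`|h w| ^+ m - `|k w| ^+ m); nra.
- exact: integrableD_fin.
Qed.

Lemma all_momentsD h k : all_moments h -> all_moments k -> all_moments (fun w => h w + k w).
Proof.
move=> [mh ih] [mk ik]; split=> [|m]; first exact: measurable_funD.
apply: (@le_integrable_fin _ _ _ _ _ (fun w => 2 ^+ m * (`|h w| ^+ m + `|k w| ^+ m))).
- by apply: measurable_funX; apply: measurableT_comp => //; exact: measurable_funD.
- move=> w; rewrite normrX normr_id.
  (* This follows from [a + b <= 2 * max a b]. *)
  have hk0 (a b : R) : 0 <= a -> 0 <= b -> (a + b) ^+ m <= 2 ^+ m * (a ^+ m + b ^+ m).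
    wlog ab : a b / a <= b => [H|] a0 b0.
      have [/H|/ltW/H] := leP a b; first exact.
      by rewrite [b + a]addrC [b ^+ m + _]addrC; exact.
    apply: (@le_trans _ _ (2 ^+ m * b ^+ m)).
      by rewrite -exprMn lerXn2r ?nnegrE; lra.
    by rewrite ler_pM2l ?exprn_gt0 // lerDr exprn_ge0.
  apply: le_trans (hk0 _ _ (normr_ge0 _) (normr_ge0 _)).
  by rewrite lerXn2r ?nnegrE ?addr_ge0 // ler_normD.
- by apply: integrableZ_fin; exact: integrableD_fin.
Qed.

Lemma all_moments_sum (I : Type) (s : seq I) (h : I -> T -> R) :
  (forall i, all_moments (h i)) -> all_moments (fun w => \sum_(i <- s) h i w).
Proof.
move=> mh; elim: s => [|i s IH].
  by under eq_fun do rewrite big_nil; exact: all_moments_cst.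
by under eq_fun do rewrite big_cons; exact: all_momentsD.
Qed.

Lemma all_moments_square_integrable h : all_moments h -> square_integrable P h.
Proof.
move=> [mh /(_ 2%N) ih]; split => //.
by under eq_fun do rewrite -real_normK ?num_real //.
Qed.

End AllMoments.

(** * Covariances of products of independent factors *)

Section IndependentCovariance.
Context {d : measure_display} {T : measurableType d} {R : realType} (P : probability T R) {n m : nat}.
Context (X : T -> 'rV[R]_n) (W : T -> 'rV[R]_m)
  (mX : random_vector X) (mW : random_vector W) (indXW : indep_rv P X W).
Implicit Types (u h : 'rV[R]_n -> R) (p q : 'rV[R]_m -> R).

(** The squares are again continuous functions of the independent vectors, so their product is
    integrable; without independence only the unsquared product would be. *)
Lemma square_integrable_indepM u p : continuous u -> continuous p ->
  square_integrable P (fun w => u (X w)) -> square_integrable P (fun w => p (W w)) ->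
  square_integrable P (fun w => p (W w) * u (X w)).
Proof.
move=> cu cp [mu iu] [mp ip]; split; first exact: measurable_funM.
under eq_fun do rewrite exprMn mulrC.
have cX k (f : 'rV[R]_k -> R) : continuous f -> continuous (fun x => f x ^+ 2).
  by move=> cf x; apply: continuousM; exact: cf.
exact: (indep_rv_expectM mX mW indXW (cX _ _ cu) (cX _ _ cp) iu ip).1.
Qed.

Lemma Expect_indepM u p : continuous u -> continuous p ->
  P.-integrable setT (fun w => (u (X w))%:E) -> P.-integrable setT (fun w => (p (W w))%:E) ->
  Expect P (fun w => p (W w) * u (X w)) = Expect P (fun w => p (W w)) * Expect P (fun w => u (X w)).
Proof.
move=> cu cp iu ip; rewrite [RHS]mulrC -(indep_rv_expectM mX mW indXW cu cp iu ip).2.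
by congr Expect; apply/funext => w; rewrite mulrC.
Qed.

(** Once the factors in [W] and those in [X] are grouped, independence splits every expectation. *)
Lemma Cov_indepM u h p q : continuous u -> continuous h -> continuous p -> continuous q ->
  square_integrable P (fun w => u (X w)) -> square_integrable P (fun w => h (X w)) ->
  square_integrable P (fun w => p (W w)) -> square_integrable P (fun w => q (W w)) ->
  Cov P (fun w => p (W w) * u (X w)) (fun w => q (W w) * h (X w)) =
  Expect P (fun w => p (W w) * q (W w)) * Expect P (fun w => u (X w) * h (X w)) -
  Expect P (fun w => p (W w)) * Expect P (fun w => u (X w)) *
  (Expect P (fun w => q (W w)) * Expect P (fun w => h (X w))).
Proof.
move=> cu ch cp cq su sh sp sq; rewrite /Cov; congr (_ - _ * _).
- rewrite -(@Expect_indepM (fun x => u x * h x) (fun x => p x * q x)).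
  + by congr Expect; apply/funext => w; rewrite mulrACA.
  + by move=> x; apply: continuousM; [exact: cu|exact: ch].
  + by move=> x; apply: continuousM; [exact: cp|exact: cq].
  + exact: square_integrableM.
  + exact: square_integrableM.
- by apply: Expect_indepM => //; exact: square_integrable_integrable.
- by apply: Expect_indepM => //; exact: square_integrable_integrable.
Qed.

End IndependentCovariance.

(** * Expansion of the covariance under additive noise *)

Section NoisyEstimator.
Context {dd : measure_display} {T : measurableType dd} {R : realType} (P : probability T R) {n : nat}
  (X W : T -> 'rV[R]_n)
  (mX : random_vector X) (mW : random_vector W) (indXW : indep_rv P X W)
  (EW : forall i : 'I_n, Expect P (fun w => W w 0 i) = 0)
  (CovW : forall i j : 'I_n, Cov P (fun w => W w 0 i) (fun w => W w 0 j) = (i == j)%:R)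
  (momW : forall (k : nat) (i : 'I_n), P.-integrable setT (fun w => (`|W w 0 i| ^+ k)%:E)).
Implicit Types (f g u : 'rV[R]_n -> R).

Definition square_integrable_derivatives f := forall l : seq 'I_n, (size l <= 2)%N ->
  P.-integrable setT (fun w => ((dpartial l f (X w)) ^+ 2)%:E).

Lemma all_moments_noise i : all_moments P (fun w => W w 0 i).
Proof. by split; [exact: mW|move=> k; exact: momW]. Qed.

Lemma Expect_noiseM i j : Expect P (fun w => W w 0 i * W w 0 j) = (i == j)%:R.
Proof. by rewrite -(CovW i j) /Cov !EW mulr0 subr0. Qed.

Lemma square_integrable_dpartial f (l : seq 'I_n) : C3_bounded_third f ->
  square_integrable_derivatives f -> (size l <= 2)%N ->
  square_integrable P (fun w => dpartial l f (X w)).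
Proof.
move=> [_ cf _] sf l2; split; last exact: sf.
by apply: continuous_random_vector => //; apply: cf; exact: leqW.
Qed.

Lemma continuous_coordM (i j : 'I_n) : continuous (fun x : 'rV[R]_n => x 0 i * x 0 j).
Proof. by move=> x; apply: continuousM; exact: coord_continuous. Qed.

Lemma square_integrable_noise1 i : square_integrable P (fun w => W w 0 i).
Proof. exact/all_moments_square_integrable/all_moments_noise. Qed.

Lemma square_integrable_noise2 i j : square_integrable P (fun w => W w 0 i * W w 0 j).
Proof. by apply/all_moments_square_integrable/all_momentsM; exact: all_moments_noise. Qed.

Section FirstOrder.
Context (f : 'rV[R]_n -> R) (Cf : C3_bounded_third f) (Sf : square_integrable_derivatives f).

Lemma continuous_dpartial (l : seq 'I_n) : (size l <= 3)%N -> continuous (dpartial l f).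
Proof. by case: Cf => _ + _; exact. Qed.

Lemma square_integrable_taylor1_term i :
  square_integrable P (fun w => W w 0 i * dpartial [:: i] f (X w)).
Proof.
apply: (@square_integrable_indepM _ _ _ _ _ _ X W mX mW indXW (dpartial [:: i] f) (fun x => x 0 i)).
- exact: continuous_dpartial.
- exact: coord_continuous.
- exact: square_integrable_dpartial.
- exact: square_integrable_noise1.
Qed.

Lemma square_integrable_taylor1 : square_integrable P (fun w => taylor1 f (X w) (W w)).
Proof. by apply: square_integrable_sum => i; exact: square_integrable_taylor1_term. Qed.

(** Each term becomes a noise monomial times a function of [x], the form to which independence
    applies. *)
Lemma taylor2E x w : taylor2 f x w =
  2^-1 * \sum_(i < n) \sum_(j < n) (w 0 i * w 0 j) * dpartial [:: j; i] f x.
Proof.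
congr (_ * _); apply: eq_bigr => i _; rewrite big_distrr /=.
by apply: eq_bigr => j _; rewrite mulrA.
Qed.

Lemma square_integrable_taylor2_term i j :
  square_integrable P (fun w => (W w 0 i * W w 0 j) * dpartial [:: j; i] f (X w)).
Proof.
apply: (@square_integrable_indepM _ _ _ _ _ _ X W mX mW indXW (dpartial [:: j; i] f)
  (fun x => x 0 i * x 0 j)).
- exact: continuous_dpartial.
- exact: continuous_coordM.
- exact: square_integrable_dpartial.
- exact: square_integrable_noise2.
Qed.

Lemma square_integrable_taylor2 : square_integrable P (fun w => taylor2 f (X w) (W w)).
Proof.
under eq_fun do rewrite taylor2E.
apply: square_integrableZ; apply: square_integrable_sum => i; apply: square_integrable_sum => j.
exact: square_integrable_taylor2_term.
Qed.

(** Each term is linear in a noise coordinate, so both parts of its covariance with [u (X w)]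
    contain a factor [E W_i = 0]. *)
Lemma Cov_taylor1_eq0 u : continuous u -> square_integrable P (fun w => u (X w)) ->
  Cov P (fun w => u (X w)) (fun w => taylor1 f (X w) (W w)) = 0.
Proof.
move=> cu su; rewrite Cov_sumr //; last exact: square_integrable_taylor1_term.
rewrite big1 // => i _.
(* The constant 1 serves as the noise factor, to match the product form of [Cov_indepM]. *)
have E1 : (fun w => u (X w)) = (fun w => (fun=> 1 : R) (W w) * u (X w)).
  by apply/funext => w; rewrite mul1r.
rewrite E1 (@Cov_indepM _ _ _ _ _ _ X W mX mW indXW u (dpartial [:: i] f) (fun=> 1) (fun x => x 0 i)) //.
- under eq_fun do rewrite mul1r.
  by rewrite EW !(mul0r, mulr0) subr0.
- exact: continuous_dpartial.
- exact: cst_continuous.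
- exact: coord_continuous.
- exact: square_integrable_dpartial.
- exact: square_integrable_cst.
- exact: square_integrable_noise1.
Qed.

(** The factor [E (W_i W_j)] removes the mixed second derivatives and leaves the pure ones, whose
    sum is the Laplacian. *)
Lemma Cov_taylor2 u : continuous u -> square_integrable P (fun w => u (X w)) ->
  Cov P (fun w => u (X w)) (fun w => taylor2 f (X w) (W w)) =
  2^-1 * Cov P (fun w => u (X w)) (fun w => laplacian f (X w)).
Proof.
move=> cu su; under [X in Cov P _ X]eq_fun do rewrite taylor2E.
have S2 := square_integrable_taylor2_term.
have Ss i : square_integrable P
    (fun w => \sum_(j < n) (W w 0 i * W w 0 j) * dpartial [:: j; i] f (X w)).
  by apply: square_integrable_sum => j.
rewrite CovC CovZl //; last exact: square_integrable_sum.
congr (_ * _); rewrite CovC.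
rewrite Cov_sumr // /laplacian Cov_sumr //; last first.
  by move=> i; apply: (square_integrable_dpartial (l := [:: i; i])).
apply: eq_bigr => i _; rewrite Cov_sumr //.
have E1 : (fun w => u (X w)) = (fun w => (fun=> 1 : R) (W w) * u (X w)).
  by apply/funext => w; rewrite mul1r.
have C2 j : Cov P (fun w => u (X w)) (fun w => (W w 0 i * W w 0 j) * dpartial [:: j; i] f (X w)) =
    (i == j)%:R * Cov P (fun w => u (X w)) (fun w => dpartial [:: j; i] f (X w)).
  rewrite {1}E1 (@Cov_indepM _ _ _ _ _ _ X W mX mW indXW u (dpartial [:: j; i] f)
     (fun=> 1) (fun x => x 0 i * x 0 j)) //.
  - under eq_fun do rewrite mul1r.
    rewrite Expect_noiseM /Cov /Expect Rintegral_cst // (congr1 fine (probability_setT P)) /=.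
    ring.
  - exact: continuous_dpartial.
  - exact: cst_continuous.
  - exact: continuous_coordM.
  - exact: square_integrable_dpartial.
  - exact: square_integrable_cst.
  - exact: square_integrable_noise2.
rewrite (eq_bigr _ (fun j _ => C2 j)) (bigD1 i) // eqxx mul1r big1.
  exact: addr0.
by move=> j ji; rewrite eq_sym (negbTE ji) mul0r.
Qed.

(** The bound of [C3_taylor] is a polynomial in the absolute noise coordinates, hence has all
    moments. *)
Lemma taylor_remainder_bound : exists H : T -> R, square_integrable P H /\
  forall (s : R) w, 0 < s ->
  `|f (X w + s *: W w) - (f (X w) + s * taylor1 f (X w) (W w) + s ^+ 2 * taylor2 f (X w) (W w))|
    <= s ^+ 3 * H w.
Proof.
have [M fM] := C3_taylor Cf.
exists (fun w => \sum_(i < n) `|W w 0 i| * \sum_(j < n) `|W w 0 j| *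
          \sum_(k < n) `|W w 0 k| * M [:: k; j; i]); split; last first.
  by move=> s w s0; exact/fM/ltW.
have mnW i := all_moments_norm (all_moments_noise i).
apply: all_moments_square_integrable.
do 3 (apply: all_moments_sum => ?; apply: all_momentsM => //).
exact: all_moments_cst.
Qed.

Lemma measurable_noisy (s : R) : measurable_fun setT (fun w => f (X w + s *: W w)).
Proof.
apply: (continuous_random_vector (X := fun w => X w + s *: W w)); last exact: (continuous_dpartial (l := [::])).
move=> i; under eq_fun do rewrite !mxE.
by apply: measurable_funD => //; apply: measurable_funM.
Qed.

End FirstOrder.

(** The product of means vanishes with [E W], and [E (W_i W_j)] keeps only the diagonal, which is
    the expected inner product of the gradients. *)
Lemma Cov_taylor1_taylor1 f g : C3_bounded_third f -> square_integrable_derivatives f ->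
  C3_bounded_third g -> square_integrable_derivatives g ->
  Cov P (fun w => taylor1 f (X w) (W w)) (fun w => taylor1 g (X w) (W w)) = VarW P X f g.
Proof.
move=> Cf Sf Cg Sg.
rewrite Cov_suml; [|by move=> i; exact: square_integrable_taylor1_term|exact: square_integrable_taylor1].
have C2 i j : Cov P (fun w => W w 0 i * dpartial [:: i] f (X w)) (fun w => W w 0 j * dpartial [:: j] g (X w)) =
    (i == j)%:R * Expect P (fun w => dpartial [:: i] f (X w) * dpartial [:: j] g (X w)).
  rewrite (@Cov_indepM _ _ _ _ _ _ X W mX mW indXW (dpartial [:: i] f) (dpartial [:: j] g)
     (fun x => x 0 i) (fun x => x 0 j)) //.
  - by rewrite !EW Expect_noiseM !mul0r subr0.
  - exact: continuous_dpartial.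
  - exact: continuous_dpartial.
  - exact: coord_continuous.
  - exact: coord_continuous.
  - exact: square_integrable_dpartial.
  - exact: square_integrable_dpartial.
  - exact: square_integrable_noise1.
  - exact: square_integrable_noise1.
rewrite /VarW /grad_dot.
(* Linearity of the expectation, by induction on the index list. *)
have -> : Expect P (fun w => \sum_(i < n) partial i f (X w) * partial i g (X w)) =
    \sum_(i < n) Expect P (fun w => partial i f (X w) * partial i g (X w)).
  have I i : P.-integrable setT (fun w => (partial i f (X w) * partial i g (X w))%:E).
    by apply: square_integrableM; apply: (square_integrable_dpartial (l := [:: i])).
  elim: (index_enum _) => [|i l IH].
    rewrite big_nil; under eq_fun do rewrite big_nil.
    by rewrite /Expect Rintegral_cst // mul0r.
  rewrite big_cons -IH; under eq_fun do rewrite big_cons.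
  rewrite ExpectD //; elim: l {IH} => [|j l IH].
    by under eq_fun do rewrite big_nil; exact: (finite_measure_integrable_cst P 0).
  by under eq_fun do rewrite big_cons; exact: integrableD_fin.
apply: eq_bigr => i _; rewrite Cov_sumr; [|exact: square_integrable_taylor1_term|by move=> j; exact: square_integrable_taylor1_term].
rewrite (eq_bigr _ (fun j _ => C2 i j)) (bigD1 i) // eqxx mul1r big1.
  exact: addr0.
by move=> j ji; rewrite eq_sym (negbTE ji) mul0r.
Qed.

(** The first-order terms paired together give [VarW]; each function paired with the second-order
    term of the other gives half a covariance with a Laplacian. *)
Lemma cvg_Cov_noisy f g : C3_bounded_third f -> square_integrable_derivatives f ->
  C3_bounded_third g -> square_integrable_derivatives g ->
  (Cov P (fun w => f (X w + s *: W w)) (fun w => g (X w + s *: W w)) -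
   Cov P (fun w => f (X w)) (fun w => g (X w))) / s ^+ 2 @[s --> 0^'+] -->
  VarW P X f g + 2^-1 * (Cov P (fun w => f (X w)) (fun w => laplacian g (X w)) +
                         Cov P (fun w => g (X w)) (fun w => laplacian f (X w))).
Proof.
move=> Cf Sf Cg Sg.
have cf := continuous_dpartial Cf (l := [::]) isT.
have cg := continuous_dpartial Cg (l := [::]) isT.
have Sf0 := square_integrable_dpartial (l := [::]) Cf Sf isT.
have Sg0 := square_integrable_dpartial (l := [::]) Cg Sg isT.
have [Hf [SHf fH]] := taylor_remainder_bound Cf.
have [Hg [SHg gH]] := taylor_remainder_bound Cg.
have C10 : Cov P (fun w => taylor1 f (X w) (W w)) (fun w => g (X w)) = 0.
  by rewrite CovC (Cov_taylor1_eq0 Cf Sf cg Sg0).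
have := cvg_Cov_cubic Sf0 (square_integrable_taylor1 Cf Sf) (square_integrable_taylor2 Cf Sf) SHf
  Sg0 (square_integrable_taylor1 Cg Sg) (square_integrable_taylor2 Cg Sg) SHg
  (measurable_noisy Cf) (measurable_noisy Cg) fH gH (Cov_taylor1_eq0 Cg Sg cf Sf0) C10.
rewrite (Cov_taylor1_taylor1 Cf Sf Cg Sg) (Cov_taylor2 Cg Sg cf Sf0).
by rewrite [X in _ + (_ + X)]CovC (Cov_taylor2 Cf Sf cg Sg0) -mulrDr.
Qed.

End NoisyEstimator.

(** * The limit formula and the case of constant Laplacians *)

Unset Implicit Arguments.

Theorem mainTheorem6 (dd : measure_display) (T : measurableType dd) (R : realType)
  (P : probability T R) (n m : nat)
  (X W : T -> 'rV[R]_n) (theta : 'I_m -> 'rV[R]_n -> R) :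
  random_vector X -> random_vector W ->
  (forall a : 'I_m, C3_bounded_third (theta a)) ->
  (forall (a : 'I_m) (s : seq 'I_n), (size s <= 2)%N ->
     P.-integrable setT (fun w => ((dpartial s (theta a) (X w)) ^+ 2)%:E)) ->
  indep_rv P X W ->
  (forall i : 'I_n, Expect P (fun w => W w 0 i) = 0) ->
  (forall i j : 'I_n, Cov P (fun w => W w 0 i) (fun w => W w 0 j) = (i == j)%:R) ->
  (forall (k : nat) (i : 'I_n),
     P.-integrable setT (fun w => (`|W w 0 i| ^+ k)%:E)) ->
  forall a b : 'I_m,
    let g := fun sigma : R =>
      (Cov P (fun w => theta a (X w + sigma *: W w)) (fun w => theta b (X w + sigma *: W w))
       - Cov P (fun w => theta a (X w)) (fun w => theta b (X w))) / sigma ^+ 2 in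
    let corr := 2^-1 * (Cov P (fun w => theta a (X w)) (fun w => laplacian (theta b) (X w))
                      + Cov P (fun w => theta b (X w)) (fun w => laplacian (theta a) (X w))) in
    [/\ g sigma @[sigma --> 0^'+] --> VarW P X (theta a) (theta b) + corr,
        VarW P X (theta a) (theta b) = lim (g sigma @[sigma --> 0^'+]) - corr &
        ((forall c : 'I_m, exists k : R, forall x, laplacian (theta c) x = k) ->
         g sigma @[sigma --> 0^'+] --> VarW P X (theta a) (theta b))].
Proof.
move=> mX mW Ctheta Stheta indXW EW CovW momW a b g corr.
have L : g sigma @[sigma --> 0^'+] --> VarW P X (theta a) (theta b) + corr.
  exact: (cvg_Cov_noisy mX mW indXW EW CovW momW (Ctheta a) (Stheta a) (Ctheta b) (Stheta b)).
split=> //; first by rewrite (cvg_lim _ L) ?addrK.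
(* Covariance with a constant is zero, so constant Laplacians make the correction vanish. *)
move=> lap; suff c0 : corr = 0 by move: L; rewrite c0 addr0.
have S c := square_integrable_dpartial (l := [::]) mX (Ctheta c) (Stheta c) isT.
have lapc c h : square_integrable P h -> Cov P h (fun w => laplacian (theta c) (X w)) = 0.
  move=> sh; have [k lk] := lap c.
  rewrite (_ : (fun w => laplacian (theta c) (X w)) = fun=> k); first exact: Cov_cstr.
  by apply/funext => w; exact: lk.
by rewrite /corr (lapc b _ (S a)) (lapc a _ (S b)) addr0 mulr0.
Qed.
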